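(* The lattice of basic varieties of regular languages (ordered by inclusion, i.e. $(V_\Sigma)_\Sigma\le (V'_\Sigma)_\Sigma$ iff $V_\Sigma\subseteq V'_\Sigma$ for every finite set $\Sigma$) is isomorphic to the lattice of pseudovarieties of lattice bimodules (ordered by inclusion).
   Context: A completely distributive lattice (CDL) is a complete lattice satisfying $\bigvee_{i\in I}\bigwedge_{j\in J_i}x_{i,j}=\bigwedge_{f\in F}\bigvee_{i\in I}x_{i,f(i)}$ for every family of elements, where $F$ is the set of choice functions $f$ with $f(i)\in J_i$. CDL-morphisms are maps preserving all (possibly empty) joins and meets. A lattice bimodule $(M,D)=(M,D,\iota,\triangleright,\triangleleft)$ consists of a monoid $(M,\cdot,1)$, a CDL $D$, and operations $\triangleright\colon M\times D\to D$, $\triangleleft\colon D\times M\to D$, $\iota\colon M\to D$ such that for all $m,n\in M$, $d\in D$, $d_i\in D$ ($i\in I$, any index set): $(mn)\triangleright d=m\triangleright(n\triangleright d)$, $d\triangleleft(mn)=(d\triangleleft m)\triangleleft n$, $1\triangleright d=d=d\triangleleft 1$, $(m\triangleright d)\triangleleft n=m\triangleright(d\triangleleft n)$; the maps $m\triangleright(-)$ and $(-)\triangleleft m$ preserve all joins and all meets; $m\triangleright\iota(n)=\iota(mn)=\iota(m)\triangleleft n$. A homomorphism $h=(h^\star,h^\diamond)\colon(M,D)\to(M',D')$ consists of a monoid homomorphism $h^\star\colon M\to M'$ and a CDL-morphism $h^\diamond\colon D\to D'$ commuting with $\triangleright,\triangleleft,\iota$. ''Injective''/''surjective'' homomorphism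 means both components are injective/surjective. A quotient bimodule of $(M,D)$ is represented by a surjective homomorphism with domain $(M,D)$. Products are componentwise. $(M,D)$ is finite if both $M$ and $D$ are finite. $(M,D)$ is $\star$-generated if every $d\in D$ can be written $d=\bigvee_{i\in I}\bigwedge_{j\in J_i}\iota(m_{i,j})$ with $m_{i,j}\in M$. $(M,D)$ is reduced if every surjective homomorphism $h\colon(M,D)\to(M',D')$ for which $h^\diamond$ is a CDL-isomorphism is an isomorphism of lattice bimodules. A pseudovariety of lattice bimodules is a class $\mathcal V$ of $\star$-generated reduced finite lattice bimodules such that (1) if $(M,D)\in\mathcal V$, $e\colon(M,D)\to(M',D')$ is a surjective homomorphism and $(M',D')$ is reduced, then $(M',D')\in\mathcal V$; (2) if $(M,D)\to\prod_{i=1}^n(M_i,D_i)$ is an injective homomorphism with $(M_i,D_i)\in\mathcal V$ for $i=1,\dots,n$ and $(M,D)$ is $\star$-generated, then $(M,D)\in\mathcal V$. Here $n\ge 0$; the empty product is the trivial bimodule $(1,1)$. For a finite set $\Sigma$, $\Sigma^\star$ is the free monoid on $\Sigma$ and $\mathbf{Reg}_\Sigma$ is the set of regular languages over $\Sigma$. The derivatives of $L\subseteq\Sigma^\star$ are the languages $v^{-1}Lw^{-1}=\{u\in\Sigma^\star\mid vuw\in L\}$ for $v,w\in\Sigma^\star$. A local basic variety of languages over $\Sigma$ is a set $V_\Sigma\subseteq\mathbf{Reg}_\Sigma$ closed under derivatives. A basic variety of (regular) languages is a family $(V_\Sigma)_\Sigma$, indexed by all finite sets $\Sigma$, of local basic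 varieties $V_\Sigma$ over $\Sigma$ such that $L\in V_\Sigma$ implies $g^{-1}L=\{w\in\Delta^\star\mid g(w)\in L\}\in V_\Delta$ for every monoid homomorphism $g\colon\Delta^\star\to\Sigma^\star$ between free monoids on finite sets. *)

(* Defs.v *)
From HB Require Import structures.
From mathcomp Require Import all_boot all_order.
From mathcomp Require Import boolp classical_sets functions cardinality.

Set Implicit Arguments.
Unset Strict Implicit.
Unset Printing Implicit Defensive.

Import Order.TTheory.

Local Open Scope classical_set_scope.
Local Open Scope group_scope.

(** * Completely distributive lattices *)

HB.mixin Record POrder_isCDL (d : Order.disp_t) D of Order.POrder d D := {
  bigjoin : set D -> D;
  bigmeet : set D -> D;
  bigjoin_supremum : forall A : set D, supremums A (bigjoin A);
  bigmeet_infimum : forall A : set D, infimums A (bigmeet A);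
  bigjoin_bigmeet_distr :
    forall (I : Type) (J : I -> Type) (x : forall i, J i -> D),
      bigjoin (range (fun i => bigmeet (range (x i)))) =
      bigmeet (range (fun f : forall i, J i =>
        bigjoin (range (fun i => x i (f i)))))
}.

#[short(type="cdlType")]
HB.structure Definition CDL (d : Order.disp_t) :=
  {D of Order.POrder d D & POrder_isCDL d D}.

Definition preserves_joins d d' (D : cdlType d) (D' : cdlType d')
  (f : D -> D') := forall A : set D, f (bigjoin A) = bigjoin (f @` A).

Definition preserves_meets d d' (D : cdlType d) (D' : cdlType d')
  (f : D -> D') := forall A : set D, f (bigmeet A) = bigmeet (f @` A).

Definition cdl_morphism d d' (D : cdlType d) (D' : cdlType d')
  (f : D -> D') := preserves_joins f /\ preserves_meets f.

Definition cdl_isomorphism d d' (D : cdlType d) (D' : cdlType d')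
    (f : D -> D') :=
  cdl_morphism f /\
  exists g : D' -> D, [/\ cdl_morphism g, cancel f g & cancel g f].

(** * Lattice bimodules *)

Record lattice_bimodule := LatticeBimodule {
  bim_mon : monoidType;
  bim_disp : Order.disp_t;
  bim_cdl : cdlType bim_disp;
  iota_bim : bim_mon -> bim_cdl;
  lact : bim_mon -> bim_cdl -> bim_cdl;
  ract : bim_cdl -> bim_mon -> bim_cdl;
  lactM : forall m n x, lact (m * n) x = lact m (lact n x);
  ractM : forall x m n, ract x (m * n) = ract (ract x m) n;
  lact1 : forall x, lact 1 x = x;
  ract1 : forall x, ract x 1 = x;
  lract : forall m x n, ract (lact m x) n = lact m (ract x n);
  lact_joins : forall m, preserves_joins (lact m);
  lact_meets : forall m, preserves_meets (lact m);
  ract_joins : forall m, preserves_joins (ract^~ m);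
  ract_meets : forall m, preserves_meets (ract^~ m);
  lact_iota : forall m n, lact m (iota_bim n) = iota_bim (m * n);
  ract_iota : forall m n, ract (iota_bim m) n = iota_bim (m * n)
}.

Record bimodule_hom (B B' : lattice_bimodule) := BimoduleHom {
  hom_star : bim_mon B -> bim_mon B';
  hom_diamond : bim_cdl B -> bim_cdl B';
  hom_star_morph : monoid_morphism hom_star;
  hom_diamond_morph : cdl_morphism hom_diamond;
  hom_lact : forall m x,
    hom_diamond (lact m x) = lact (hom_star m) (hom_diamond x);
  hom_ract : forall x m,
    hom_diamond (ract x m) = ract (hom_diamond x) (hom_star m);
  hom_iota : forall m, hom_diamond (iota_bim m) = iota_bim (hom_star m)
}.

Definition hom_injective B B' (h : bimodule_hom B B') :=
  injective (hom_star h) /\ injective (hom_diamond h).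

Definition hom_surjective B B' (h : bimodule_hom B B') :=
  set_surj setT setT (hom_star h) /\ set_surj setT setT (hom_diamond h).

Definition bimodule_isomorphism B B' (h : bimodule_hom B B') :=
  exists k : bimodule_hom B' B,
    [/\ cancel (hom_star h) (hom_star k),
        cancel (hom_star k) (hom_star h),
        cancel (hom_diamond h) (hom_diamond k)
      & cancel (hom_diamond k) (hom_diamond h)].

Definition finite_bimodule (B : lattice_bimodule) :=
  finite_set [set: bim_mon B] /\ finite_set [set: bim_cdl B].

Definition star_generated (B : lattice_bimodule) :=
  forall x : bim_cdl B,
    exists (I : Type) (J : I -> Type) (m : forall i, J i -> bim_mon B),
      x = bigjoin (range (fun i =>
            bigmeet (range (fun j => iota_bim (m i j))))).

Definition reduced (B : lattice_bimodule) :=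
  forall (B' : lattice_bimodule) (h : bimodule_hom B B'),
    hom_surjective h -> cdl_isomorphism (hom_diamond h) ->
    bimodule_isomorphism h.

(** * Products *)

Section ProdMonoid.
Variables (I : Type) (M : I -> monoidType).

Definition prod_monoid : Type := forall i, M i.

HB.instance Definition _ := Choice.copy prod_monoid (forall i, M i).

Definition prod_one : prod_monoid := fun=> 1.
Definition prod_mul (f g : prod_monoid) : prod_monoid := fun i => f i * g i.

Fact prod_mulA : associative prod_mul.
Proof. by move=> f g h; apply: functional_extensionality_dep => i; apply: mulgA. Qed.

Fact prod_mul1 : left_id prod_one prod_mul.
Proof. by move=> f; apply: functional_extensionality_dep => i; apply: mul1g. Qed.

Fact prod_mulr1 : right_id prod_one prod_mul.
Proof. by move=> f; apply: functional_extensionality_dep => i; apply: mulg1. Qed.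

HB.instance Definition _ :=
  isMonoid.Build prod_monoid prod_mulA prod_mul1 prod_mulr1.

End ProdMonoid.

Fact prod_cdl_display : Order.disp_t. Proof. exact: Order.Disp tt tt. Qed.

Section ProdCDL.
Variables (I : Type) (d : I -> Order.disp_t) (D : forall i, cdlType (d i)).

Definition prod_cdl : Type := forall i, D i.

HB.instance Definition _ := Choice.copy prod_cdl (forall i, D i).

Implicit Types (f g h : prod_cdl) (A : set prod_cdl).

Definition prod_le f g : bool := `[< forall i, (f i <= g i)%O >].

Fact prod_le_refl : reflexive prod_le.
Proof. by move=> f; apply/asboolP. Qed.

Fact prod_le_anti : antisymmetric prod_le.
Proof.
move=> f g /andP[/asboolP fg /asboolP gf].
by apply: functional_extensionality_dep => i; apply/le_anti; rewrite fg gf.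
Qed.

Fact prod_le_trans : transitive prod_le.
Proof.
move=> g f h /asboolP fg /asboolP gh; apply/asboolP => i.
exact: le_trans (fg i) (gh i).
Qed.

HB.instance Definition _ := Order.Le_isPOrder.Build prod_cdl_display prod_cdl
  prod_le_refl prod_le_anti prod_le_trans.

Definition prod_bigjoin A : prod_cdl := fun i => bigjoin [set f i | f in A].
Definition prod_bigmeet A : prod_cdl := fun i => bigmeet [set f i | f in A].

Fact prod_bigjoin_supremum A : supremums A (prod_bigjoin A).
Proof.
split=> [f Af|g ubg]; apply/asboolP => i.
  by case: (bigjoin_supremum [set f i | f in A]) => + _; apply; exists f.
case: (bigjoin_supremum [set f i | f in A]) => _; apply=> _ [f Af <-].
by have /asboolP := ubg f Af; apply.
Qed.

Fact prod_bigmeet_infimum A : infimums A (prod_bigmeet A).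
Proof.
split=> [f Af|g lbg]; apply/asboolP => i.
  by case: (bigmeet_infimum [set f i | f in A]) => + _; apply; exists f.
case: (bigmeet_infimum [set f i | f in A]) => _; apply=> _ [f Af <-].
by have /asboolP := lbg f Af; apply.
Qed.

Fact prod_distr (K : Type) (J : K -> Type) (x : forall k, J k -> prod_cdl) :
  prod_bigjoin (range (fun k => prod_bigmeet (range (x k)))) =
  prod_bigmeet (range (fun f : forall k, J k =>
    prod_bigjoin (range (fun k => x k (f k))))).
Proof.
apply: functional_extensionality_dep => i.
rewrite /prod_bigjoin /prod_bigmeet !image_comp.
transitivity (bigjoin (range (fun k => bigmeet (range (fun j => x k j i))))).
  by congr bigjoin; apply: eq_imagel => k _ /=; rewrite image_comp.
rewrite bigjoin_bigmeet_distr; congr bigmeet.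
by apply: eq_imagel => f _ /=; rewrite image_comp.
Qed.

HB.instance Definition _ := POrder_isCDL.Build prod_cdl_display prod_cdl
  prod_bigjoin_supremum prod_bigmeet_infimum prod_distr.

End ProdCDL.

Section ProdBimodule.
Variables (I : Type) (B : I -> lattice_bimodule).

Let M := prod_monoid (fun i => bim_mon (B i)).
Let D := prod_cdl (fun i => bim_cdl (B i)).

Definition prod_iota (m : M) : D := fun i => iota_bim (m i).
Definition prod_lact (m : M) (x : D) : D := fun i => lact (m i) (x i).
Definition prod_ract (x : D) (m : M) : D := fun i => ract (x i) (m i).

Definition prod_bimodule : lattice_bimodule.
Proof.
refine (@LatticeBimodule M prod_cdl_display D prod_iota prod_lact prod_ract
  _ _ _ _ _ _ _ _ _ _ _).
- by move=> m n x; apply: functional_extensionality_dep => i; apply: lactM.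
- by move=> x m n; apply: functional_extensionality_dep => i; apply: ractM.
- by move=> x; apply: functional_extensionality_dep => i; apply: lact1.
- by move=> x; apply: functional_extensionality_dep => i; apply: ract1.
- by move=> m x n; apply: functional_extensionality_dep => i; apply: lract.
- move=> m A; apply: functional_extensionality_dep => i.
  by rewrite /prod_lact lact_joins /bigjoin /= /prod_bigjoin !image_comp.
- move=> m A; apply: functional_extensionality_dep => i.
  by rewrite /prod_lact lact_meets /bigmeet /= /prod_bigmeet !image_comp.
- move=> m A; apply: functional_extensionality_dep => i.
  by rewrite /prod_ract ract_joins /bigjoin /= /prod_bigjoin !image_comp.
- move=> m A; apply: functional_extensionality_dep => i.
  by rewrite /prod_ract ract_meets /bigmeet /= /prod_bigmeet !image_comp.
- by move=> m n; apply: functional_extensionality_dep => i; apply: lact_iota.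
- by move=> m n; apply: functional_extensionality_dep => i; apply: ract_iota.
Defined.

End ProdBimodule.

(** * Pseudovarieties of lattice bimodules *)

(* [n] may be 0 in [pv_subprod], so every pseudovariety contains the trivial
   bimodules.  The class is a plain predicate because [set] is universe
   monomorphic and does not apply to the large type [lattice_bimodule]. *)
Record pseudovariety := Pseudovariety {
  pv_class :> lattice_bimodule -> Prop;
  pv_members : forall B, pv_class B ->
    [/\ star_generated B, reduced B & finite_bimodule B];
  pv_quotient : forall B B' (e : bimodule_hom B B'),
    pv_class B -> hom_surjective e -> reduced B' -> pv_class B';
  pv_subprod : forall (n : nat) (Bs : 'I_n -> lattice_bimodule)
      (B : lattice_bimodule) (h : bimodule_hom B (prod_bimodule Bs)),
    hom_injective h -> (forall i, pv_class (Bs i)) -> star_generated B ->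
    pv_class B
}.

Definition pseudovariety_le (V W : pseudovariety) :=
  forall B : lattice_bimodule, pv_class V B -> pv_class W B.

(** * Languages *)

Definition word (S : finType) : Type := seq S.

HB.instance Definition _ (S : finType) := Choice.on (word S).
HB.instance Definition _ (S : finType) :=
  isMonoid.Build (word S) (@catA S) (@cat0s S) (@cats0 S).

Definition language (S : finType) := set (word S).

(* Acceptance by a finite deterministic automaton. *)
Definition regular (S : finType) (L : language S) :=
  exists (Q : finType) (q0 : Q) (delta : Q -> S -> Q) (F : {set Q}),
    L = [set w : word S | foldl delta q0 w \in F].

Definition derivative (S : finType) (v w : word S) (L : language S) :
  language S := [set u | L (v * u * w)].

Definition local_basic_variety (S : finType) (V : set (language S)) :=
  V `<=` @regular S /\ forall L v w, V L -> V (derivative v w L).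

Record basic_variety := BasicVariety {
  bv_langs :> forall S : finType, set (language S);
  bv_local : forall S, local_basic_variety (@bv_langs S);
  bv_preimage : forall (S T : finType) (g : word T -> word S) L,
    monoid_morphism g -> bv_langs L -> bv_langs (g @^-1` L)
}.

Arguments bv_langs V S _ : clear implicits, rename.

Definition basic_variety_le (V W : basic_variety) :=
  forall S : finType, bv_langs V S `<=` bv_langs W S.

(** * Lattices given by an order relation *)

(* A propositional counterpart of [latticeType], whose order is boolean. *)
Definition is_lattice (T : Type) (le : T -> T -> Prop) :=
  [/\ (forall x, le x x) /\ (forall x y z, le x y -> le y z -> le x z),
      forall x y, le x y -> le y x -> x = y,
      forall x y, exists z,
        [/\ le x z, le y z & forall t, le x t -> le y t -> le z t]
    & forall x y, exists z,
        [/\ le z x, le z y & forall t, le t x -> le t y -> le t z]].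

(* An order isomorphism automatically preserves binary joins and meets. *)
Definition lattice_isomorphism (T U : Type) (leT : T -> T -> Prop)
    (leU : U -> U -> Prop) (f : T -> U) :=
  bijective f /\ forall x y, leT x y <-> leU (f x) (f y).

(* Main.v *)
(* An Eilenberg correspondence.  By finite duality a finite CDL is determined by
   its points, the complete morphisms to the two-element chain; for a
   star-generated bimodule (M, D), composing a point with iota gives a subset of
   M, these subsets determine the point and are closed under derivatives, and
   (M, D) is reduced iff iota is injective, i.e. iff these subsets separate M.
   So a finite reduced star-generated bimodule is a finite monoid with a separating,
   derivative-closed set of subsets.  A basic variety W is sent to the class of
   those bimodules all of whose recognised languages lie in W, and a
   pseudovariety to the languages recognised by its members.  W is recovered
   because the syntactic bimodule of L in W only recognises preimages of
   derivatives of L.  A pseudovariety V is recovered because if every language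
   recognised by (M, D) is recognised in V, choose for each of the finitely many
   points of D a member of V recognising the corresponding language over the
   alphabet M: (M, D) is a quotient of a subbimodule of their product. *)
From HB Require Import structures.
Require Import Defs.
From mathcomp Require Import all_boot all_order.
From mathcomp Require Import boolp classical_sets functions cardinality.

Set Implicit Arguments.
Unset Strict Implicit.
Unset Printing Implicit Defensive.

Import Order.TTheory.

Local Open Scope classical_set_scope.
Local Open Scope group_scope.

(** * Finite sets *)

Lemma finite_set_enum T : finite_set [set: T] ->
  exists n (e : 'I_n -> T), forall x, exists i, e i = x.
Proof.
case/finite_set_leP=> n /pcard_leP[f].
(* [e] sends indices outside the image of [f] to a default [x0], so the empty type is treated apart,
   with [n = 0]. *)
have [[x0]|T0] := pselect (inhabited T); last first.
  exists 0, (fun i : 'I_0 => False_rect T (notF (ltn_ord i))) => x.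
  by case: T0; constructor.
have /choice[e eP] : forall i : 'I_n, exists x, (exists y, f y = i) -> f x = i.
  move=> i; have [[y fy]|] := pselect (exists y, f y = i); first by exists y.
  by exists x0.
exists n, e => x; have fx : (f x < n)%N by have : `I_n (f x) by apply: funS.
exists (Ordinal fx); apply: (@inj _ _ _ f); rewrite ?in_setE //.
by apply: eP; exists x.
Qed.

Lemma finite_set_inj T U (f : T -> U) :
  injective f -> finite_set [set: U] -> finite_set [set: T].
Proof.
by move=> finj; apply: (@finite_preimage _ _ setT f) => x y _ _; apply: finj.
Qed.

Lemma finite_set_surj (T : finType) U (A : set U) (f : T -> U) :
  (forall x, A x -> exists i, f i = x) -> finite_set A.
Proof.
move=> fsurj; apply: (@sub_finite_set _ _ (range f)).
  by move=> x /fsurj[i <-]; exists i.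
exact/finite_image/finite_finset.
Qed.

Lemma finite_set_sets T : finite_set [set: T] -> finite_set [set: set T].
Proof.
move=> /finite_set_enum[n [e esurj]].
apply: (@finite_set_surj {set 'I_n} _ _ (fun A => [set e i | i in [set` A]])) => A _.
exists [set i | e i \in A]%SET; apply/seteqP; split=> [_ [i + <-]|x Ax] /=.
  by rewrite /= inE => /set_mem.
by have [i eix] := esurj x; exists i; rewrite //= inE; apply: mem_set; rewrite eix.
Qed.

(** A dependent function is determined by its graph, a subset of the finite disjoint union of the
    [T i]. *)
Lemma finite_set_prod (I : finType) (T : I -> Type) :
  (forall i, finite_set [set: T i]) -> finite_set [set: forall i, T i].
Proof.
move=> finT.
pose graph (f : forall i, T i) := [set p : {i & T i} | f (tag p) = tagged p].
apply: (@finite_set_inj _ _ graph) => [f g fg|].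
  apply: functional_extensionality_dep => i.
  by have : graph f (Tagged T (f i)) by []; rewrite fg.
apply: finite_set_sets.
apply: (@sub_finite_set _ _ (\bigcup_(i in [set: I]) range (Tagged T (i:=i)))).
  by case=> i x _; exists i => //; exists x.
by apply: bigcup_finite => [|i _]; [apply: finite_finset|apply: finite_image].
Qed.

(** * Points of completely distributive lattices *)

Section CDLTheory.
Variables (d : Order.disp_t) (D : cdlType d).
Implicit Types (x y z : D) (A B P : set D).

Lemma le_bigjoin A x : A x -> (x <= bigjoin A)%O.
Proof. by case: (bigjoin_supremum A) => + _; apply. Qed.

Lemma bigjoin_le A x : (forall y, A y -> (y <= x)%O) -> (bigjoin A <= x)%O.
Proof. by case: (bigjoin_supremum A) => _ lubA ubx; apply: lubA. Qed.

Lemma bigmeet_le A x : A x -> (bigmeet A <= x)%O.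
Proof. by case: (bigmeet_infimum A) => + _; apply. Qed.

Lemma le_bigmeet A x : (forall y, A y -> (x <= y)%O) -> (x <= bigmeet A)%O.
Proof. by case: (bigmeet_infimum A) => _ glbA lbx; apply: glbA. Qed.

Lemma bigmeet2_idPl x y : bigmeet [set x; y] = x <-> (x <= y)%O.
Proof.
split=> [<-|xy]; first by apply: bigmeet_le; right.
apply/le_anti/andP; split; first by apply: bigmeet_le; left.
by apply: le_bigmeet => z [->|->].
Qed.

(** Complete distributivity for the pairs [x], [a] with [a] in [A]: a choice function that picks [x]
    at least once gives a join above [x], and the one that never does gives [bigjoin A]. *)
Lemma cdl_frame_distr x A :
  bigmeet [set x; bigjoin A] = bigjoin [set bigmeet [set x; a] | a in A].
Proof.
have range2 (T : Type) (f : bool -> T) : range f = [set f true; f false].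
  apply/seteqP; split=> [_ [[] _ <-]|_ [->|->]]; first by left.
  - by right.
  - by exists true.
  - by exists false.
apply/le_anti/andP; split; last first.
  apply: bigjoin_le => _ [a Aa <-]; apply: le_bigmeet => z [->|->].
    by apply: bigmeet_le; left.
  apply: (@le_trans _ _ a); last exact: le_bigjoin.
  by apply: bigmeet_le; right.
have -> : [set bigmeet [set x; a] | a in A] = range (fun a : {a | A a} =>
    bigmeet (range (fun b : bool => if b then x else sval a))).
  apply/seteqP; split=> [_ [a Aa <-]|_ [[a Aa] _ <-]].
    by exists (exist _ a Aa) => //; rewrite range2.
  by exists a => //; rewrite range2.
rewrite bigjoin_bigmeet_distr; apply: le_bigmeet => _ [f _ <-].
case: (pselect (exists a, f a)) => [[a fa]|/forallNP fN].
  apply: (@le_trans _ _ x); first by apply: bigmeet_le; left.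
  by apply: le_bigjoin; exists a => //; rewrite fa.
apply: (@le_trans _ _ (bigjoin A)); first by apply: bigmeet_le; right.
apply: bigjoin_le => a Aa; apply: le_bigjoin.
by exists (exist _ a Aa) => //; case: (f _) (fN (exist _ a Aa)).
Qed.

(* Completely prime complete filters; equivalently, complete lattice
   morphisms to the two-element chain. *)
Definition cdl_point P :=
  (forall A, P (bigjoin A) <-> exists2 x, A x & P x) /\
  (forall A, P (bigmeet A) <-> A `<=` P).

Lemma cdl_point_le P x y : cdl_point P -> (x <= y)%O -> P x -> P y.
Proof. by case=> _ Pmeet /bigmeet2_idPl <- /Pmeet; apply; right. Qed.

Lemma finite_exists_minimal A x : finite_set A -> A x ->
  exists2 p, A p & forall q, A q -> (q <= p)%O -> q = p.
Proof.
case/finite_seqP=> s ->; elim: s x => [|a s IHs] x //= _.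
have [->|[b sb]] : s = [::] \/ exists b, b \in s.
- by case: s {IHs} => [|b s]; [left|right; exists b; rewrite mem_head].
- by exists a => [|q]; rewrite /= inE // => /eqP.
have [p sp pmin] := IHs b sb.
have [ap|/negP aNp] := boolP (a <= p)%O.
  exists a => [|q]; first exact: mem_head.
  rewrite /= in_cons => /predU1P[//|sq qa].
  apply/le_anti; rewrite qa; have qp := pmin q sq (le_trans qa ap).
  by rewrite qp.
exists p => [|q]; first by rewrite /= in_cons sp orbT.
by rewrite /= in_cons => /predU1P[->//|]; apply: pmin.
Qed.

(* An element [p] minimal among those below [x] but not below [y] is completely
   join-prime, so its up-set is a point. *)
Lemma cdl_point_separates x y : finite_set [set: D] -> ~ (x <= y)%O ->
  exists P, [/\ cdl_point P, P x & ~ P y].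
Proof.
move=> finD xNy; pose Q := [set z : D | (z <= x)%O /\ ~ (z <= y)%O].
have [p [px pNy] pmin] : exists2 p, Q p & forall q, Q q -> (q <= p)%O -> q = p.
  by apply: (@finite_exists_minimal Q x) => //; apply: sub_finite_set finD.
exists [set z | (p <= z)%O]; split=> //; split=> A /=; split.
(* If no [a] in [A] were above [p], minimality would put every meet of [p] and [a] below [y], hence
   also [p], which is the join of these meets. *)
- move=> /bigmeet2_idPl pA; apply: contrapT => noA.
  apply: pNy; rewrite -pA cdl_frame_distr; apply: bigjoin_le => _ [a Aa <-].
  have ap : (bigmeet [set p; a] <= p)%O by apply: bigmeet_le; left.
  apply: contrapT => aNy; apply: noA; exists a => //.
  apply/bigmeet2_idPl/pmin => //; split=> //; exact: le_trans ap px.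
- by case=> a Aa pa; apply: le_trans pa _; apply: le_bigjoin.
- by move=> pA a Aa; apply: le_trans pA _; apply: bigmeet_le.
- by move=> Ap; apply: le_bigmeet => a /Ap.
Qed.

Lemma cdl_point_leP x y : finite_set [set: D] ->
  (forall P, cdl_point P -> P x -> P y) -> (x <= y)%O.
Proof.
move=> finD Pxy; apply: contrapT => /(cdl_point_separates finD)[P [ptP Px]].
by apply; apply: Pxy.
Qed.

Lemma cdl_point_eqP x y : finite_set [set: D] ->
  (forall P, cdl_point P -> P x <-> P y) -> x = y.
Proof.
move=> finD Pxy; apply/le_anti/andP.
by split; apply: cdl_point_leP => // P ptP; have [] := Pxy P ptP.
Qed.

End CDLTheory.

Lemma cdl_point_preimage d d' (D : cdlType d) (D' : cdlType d') (f : D -> D')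
  (P : set D') : cdl_morphism f -> cdl_point P -> cdl_point (f @^-1` P).
Proof.
move=> [fjoin fmeet] [Pjoin Pmeet]; split=> A /=; rewrite ?fjoin ?fmeet.
  rewrite Pjoin; split=> [[_ [x Ax <-] Px]|[x Ax Px]]; first by exists x.
  by exists (f x) => //; exists x.
rewrite Pmeet; split=> [sAP x Ax|sAP _ [x Ax <-]]; last exact: sAP.
by apply: sAP; exists x.
Qed.

(** Points separate the elements of a finite lattice, so preservation of joins and meets may be
    tested at each point of [D']. *)
Lemma cdl_morphism_of_points d d' (D : cdlType d) (D' : cdlType d')
    (f : D -> D') : finite_set [set: D'] ->
  (forall P, cdl_point P -> cdl_point (f @^-1` P)) -> cdl_morphism f.
Proof.
move=> finD' ptf; split=> A; apply: cdl_point_eqP => // P ptP.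
  have [/(_ A) fjoin _] := ptf P ptP; have [-> _] := ptP.
  apply: (iff_trans fjoin); split=> [[x Ax Px]|[_ [x Ax <-] Px]]; last by exists x.
  by exists (f x) => //; exists x.
have [_ /(_ A) fmeet] := ptf P ptP; have [_ ->] := ptP.
apply: (iff_trans fmeet); split=> [sAP _ [x Ax <-]|sAP x Ax]; first exact: sAP.
by apply: sAP; exists x.
Qed.

(* A point [P] of [D] is the up-set of [p := bigmeet P]; among the points of
   the [D' i] that contain [h p i], one restricts to [P]: otherwise [h p] would
   lie below [h (bigjoin (~` P))]. *)
Lemma cdl_point_subprod (I : Type) (d' : I -> Order.disp_t)
    (D' : forall i, cdlType (d' i)) d (D : cdlType d) (h : D -> prod_cdl D')
    (P : set D) : (forall i, finite_set [set: D' i]) -> cdl_morphism h ->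
    injective h -> cdl_point P ->
  exists i (P' : set (D' i)), cdl_point P' /\ P = [set x | P' (h x i)].
Proof.
move=> finD' hmor hinj ptP; have [hjoin hmeet] := hmor.
have [Pjoin Pmeet] := ptP; have Pp : P (bigmeet P) by apply/Pmeet.
set p := bigmeet P in Pp.
have [[i [P' [ptP' [P'p sP'P]]]]|noP'] := pselect (exists i (P' : set (D' i)),
    cdl_point P' /\ P' (h p i) /\ [set x | P' (h x i)] `<=` P).
  exists i, P'; split=> //; apply/seteqP; split=> // x Px /=.
  have /bigmeet2_idPl px : (p <= x)%O by apply: bigmeet_le.
  have {}px : (h p <= h x)%O.
    apply/bigmeet2_idPl; rewrite -[RHS]/(h p) -[in RHS]px hmeet image_setU.
    by rewrite !image_set1.
  by apply: (cdl_point_le ptP') P'p; move/asboolP: px; apply.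
have le_hp : (h p <= h (bigjoin (~` P)))%O.
  apply/asboolP => i; apply: cdl_point_leP => // P' ptP' P'p.
  rewrite hjoin; apply/(proj1 ptP').
  apply: contrapT => noP; apply: noP'; exists i, P'; split=> //; split=> // x P'x.
  apply: contrapT => Px; apply: noP; exists (h x i) => //.
  by exists (h x) => //; exists x.
(* Injectivity of [h] brings the inequality back to [D]: [P] then contains the join of its own
   complement, contrary to primeness. *)
have /bigmeet2_idPl le_p : bigmeet [set p; bigjoin (~` P)] = p.
  apply: hinj; rewrite hmeet image_setU !image_set1.
  exact/bigmeet2_idPl.
by have /Pjoin[x] := cdl_point_le ptP le_p Pp.
Qed.

(** * Reduced bimodules *)

Lemma star_generated_surj (B B' : lattice_bimodule) (h : bimodule_hom B B') :
  hom_surjective h -> star_generated B -> star_generated B'.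
Proof.
move=> [_ surjd] sgB y; have [x _ <-] := surjd y I.
have [J [K [m ->]]] := sgB x; exists J, K, (fun j k => hom_star h (m j k)).
have [hjoin hmeet] := hom_diamond_morph h.
rewrite hjoin image_comp; congr bigjoin; apply: eq_imagel => j _ /=.
rewrite hmeet image_comp; congr bigmeet; apply: eq_imagel => k _ /=.
exact: hom_iota.
Qed.

Lemma finite_bimodule_surj (B B' : lattice_bimodule) (h : bimodule_hom B B') :
  hom_surjective h -> finite_bimodule B -> finite_bimodule B'.
Proof.
move=> [surjs surjd] [finM finD]; split.
  by apply: sub_finite_set surjs _; apply: finite_image.
by apply: sub_finite_set surjd _; apply: finite_image.
Qed.

(** Compatibility with [iota_bim] makes [hom_star] injective as soon as [hom_diamond] is, so both
    components are bijective; cancelling [h] gives the laws for the inverse. *)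
Lemma iota_inj_reduced (B : lattice_bimodule) :
  injective (@iota_bim B) -> reduced B.
Proof.
move=> iota_inj B' h [surjs _] [_ [g [gmor hK gK]]].
have hinj : injective (hom_star h).
  move=> m n hmn; apply: iota_inj; apply: (can_inj hK).
  by rewrite !hom_iota hmn.
have [k kK] : exists k, cancel k (hom_star h).
  suff /choice[k kK] : forall y, exists x, hom_star h x = y by exists k.
  by move=> y; have [x _ <-] := surjs y I; exists x.
have hk : cancel (hom_star h) k by move=> x; apply: hinj; rewrite kK.
have [h1 hM] := hom_star_morph h.
unshelve eexists (@BimoduleHom B' B k g _ gmor _ _ _).
- split=> [|m n]; apply: hinj; first by rewrite kK h1.
  by rewrite hM !kK.
- by move=> m x; apply: (can_inj hK); rewrite hom_lact !gK kK.
- by move=> x m; apply: (can_inj hK); rewrite hom_ract !gK kK.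
- by move=> m; apply: (can_inj hK); rewrite hom_iota gK kK.
- by [].
Qed.

(** On generators, [lact m (iota_bim k)] equals [ract (iota_bim m) k], which sees only [iota_bim m];
    joins and meets of generators follow. *)
Lemma iota_eq_lact (B : lattice_bimodule) (m n : bim_mon B) :
  star_generated B -> iota_bim m = iota_bim n -> lact m =1 lact n.
Proof.
move=> sgB mn x; have [J [K [k ->]]] := sgB x.
rewrite !lact_joins !image_comp; congr bigjoin; apply: eq_imagel => j _ /=.
rewrite !lact_meets !image_comp; congr bigmeet; apply: eq_imagel => l _ /=.
by rewrite !lact_iota -!ract_iota mn.
Qed.

Lemma iota_eq_ract (B : lattice_bimodule) (m n : bim_mon B) :
  star_generated B -> iota_bim m = iota_bim n -> (@ract B)^~ m =1 (@ract B)^~ n.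
Proof.
move=> sgB mn x; have [J [K [k ->]]] := sgB x.
rewrite !(ract_joins _ _) !image_comp; congr bigjoin; apply: eq_imagel => j _ /=.
rewrite !(ract_meets _ _) !image_comp; congr bigmeet; apply: eq_imagel => l _ /=.
by rewrite !ract_iota -!lact_iota mn.
Qed.

(* If [B] is star-generated, then [iota m = iota n] already forces [m] and [n]
   to act equally, so [M] may be replaced by [iota M] without changing [D]; hence
   [B] is reduced exactly when [iota] is injective. *)
Section IotaImage.
Variable B : lattice_bimodule.

Definition iota_image : Type :=
  {x : bim_cdl B | `[< exists m, iota_bim m = x >]}.

HB.instance Definition _ := [isSub for @sval (bim_cdl B) _ : iota_image -> _].
HB.instance Definition _ := [Choice of iota_image by <:].

Fact iota_image_subproof m : `[< exists n : bim_mon B, iota_bim n = iota_bim m >].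
Proof. by apply/asboolP; exists m. Qed.

Definition iota_class m : iota_image := Sub (iota_bim m) (iota_image_subproof m).

Lemma iota_classP (x : iota_image) : exists m, iota_class m = x.
Proof.
have /asboolP[m mx] := svalP x; exists m.
by apply: val_inj.
Qed.

Definition iota_repr (x : iota_image) : bim_mon B := projT1 (cid (iota_classP x)).

Lemma iota_reprK : cancel iota_repr iota_class.
Proof. by move=> x; rewrite /iota_repr; case: cid. Qed.

Lemma iota_class_eq m n : iota_class m = iota_class n <-> iota_bim m = iota_bim n.
Proof. by split=> [/(congr1 val)|mn] //; apply: val_inj. Qed.

Definition iota_image_mul (x y : iota_image) := iota_class (iota_repr x * iota_repr y).

(** The product is independent of representatives because [iota_bim (m * n)] is both
    [lact m (iota_bim n)] and [ract (iota_bim m) n]. *)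
Lemma iota_classM m n :
  iota_image_mul (iota_class m) (iota_class n) = iota_class (m * n).
Proof.
have /iota_class_eq mE := iota_reprK (iota_class m).
have /iota_class_eq nE := iota_reprK (iota_class n).
by apply/iota_class_eq; rewrite -lact_iota nE lact_iota -ract_iota mE ract_iota.
Qed.

Fact iota_image_mulA : associative iota_image_mul.
Proof.
move=> x y z; have [m <-] := iota_classP x; have [n <-] := iota_classP y.
by have [k <-] := iota_classP z; rewrite !iota_classM mulgA.
Qed.

Fact iota_image_mul1 : left_id (iota_class 1) iota_image_mul.
Proof. by move=> x; have [m <-] := iota_classP x; rewrite iota_classM mul1g. Qed.

Fact iota_image_mulr1 : right_id (iota_class 1) iota_image_mul.
Proof. by move=> x; have [m <-] := iota_classP x; rewrite iota_classM mulg1. Qed.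

HB.instance Definition _ := isMonoid.Build iota_image
  iota_image_mulA iota_image_mul1 iota_image_mulr1.

Hypothesis sgB : star_generated B.

Lemma lact_reprK m x : lact (iota_repr (iota_class m)) x = lact m x.
Proof. by apply: iota_eq_lact => //; apply/iota_class_eq; apply: iota_reprK. Qed.

Lemma ract_reprK m x : ract x (iota_repr (iota_class m)) = ract x m.
Proof.
by apply: (iota_eq_ract sgB); apply/iota_class_eq; apply: iota_reprK.
Qed.

Definition reduction : lattice_bimodule.
Proof.
refine (@LatticeBimodule iota_image _ (bim_cdl B) val
  (fun m => lact (iota_repr m)) (fun x m => ract x (iota_repr m))
  _ _ _ _ _ _ _ _ _ _ _).
- move=> x y z; have [m <-] := iota_classP x; have [n <-] := iota_classP y.
  by rewrite [_ * _]iota_classM !lact_reprK lactM.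
- move=> z x y; have [m <-] := iota_classP x; have [n <-] := iota_classP y.
  by rewrite [_ * _]iota_classM !ract_reprK ractM.
- by move=> x; rewrite lact_reprK lact1.
- by move=> x; rewrite ract_reprK ract1.
- by move=> m x n; rewrite lract.
- by move=> m; apply: lact_joins.
- by move=> m; apply: lact_meets.
- by move=> m; apply: ract_joins.
- by move=> m; apply: ract_meets.
- move=> x y; have [m <-] := iota_classP x; have [n <-] := iota_classP y.
  by rewrite [_ * _]iota_classM lact_reprK lact_iota.
- move=> x y; have [m <-] := iota_classP x; have [n <-] := iota_classP y.
  by rewrite [_ * _]iota_classM ract_reprK ract_iota.
Defined.

Definition reduction_hom : bimodule_hom B reduction.
Proof.
refine (@BimoduleHom B reduction iota_class id _ _ _ _ _) => //.
- by split=> // m n; rewrite -iota_classM.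
- by split=> A; rewrite image_id.
- by move=> m x; rewrite /= lact_reprK.
- by move=> x m; rewrite /= ract_reprK.
Defined.

Lemma reduction_surjective : hom_surjective reduction_hom.
Proof.
split=> x _; last by exists x.
by have [m <-] := iota_classP x; exists m.
Qed.

Lemma reduction_reduced : reduced reduction.
Proof. exact/iota_inj_reduced/val_inj. Qed.

Lemma reduction_star_generated : star_generated reduction.
Proof. exact: star_generated_surj reduction_surjective sgB. Qed.

Lemma reduction_finite : finite_set [set: bim_cdl B] -> finite_bimodule reduction.
Proof.
by move=> finD; split=> //; apply: finite_set_inj finD; apply: val_inj.
Qed.

Lemma reduced_iota_inj : reduced B -> injective (@iota_bim B).
Proof.
move=> redB m n mn; have [|k [kK _ _ _]] := redB _ _ reduction_surjective.
  have idmor := hom_diamond_morph reduction_hom.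
  by split=> //; exists id.
by apply: (can_inj kK); apply/iota_class_eq.
Qed.

End IotaImage.

(** * Syntactic bimodules *)

Definition deriv (F : monoidType) (v w : F) (X : set F) : set F :=
  [set u | X (v * u * w)].

Lemma derivM (F : monoidType) (v w v' w' : F) (X : set F) :
  deriv v' w' (deriv v w X) = deriv (v * v') (w' * w) X.
Proof. by apply/seteqP; split=> u; rewrite /deriv /= !mulgA. Qed.

Lemma deriv11 (F : monoidType) (X : set F) : deriv 1 1 X = X.
Proof. by apply/seteqP; split=> u; rewrite /deriv /= mul1g mulg1. Qed.

Fact upset_display : Order.disp_t. Proof. exact: Order.Disp tt tt. Qed.

Section Upsets.
Variables (F : Type) (V : set (set F)).

(* The upsets of [V] ordered by inclusion: the CDL whose points are the
   elements of [V] (see [upset_cdl_pointP]). *)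
Record upset : Type := Upset {
  upset_val :> set F -> Prop;
  upset_sub : forall X, upset_val X -> V X;
  upset_up : forall X Y, upset_val X -> V Y -> X `<=` Y -> upset_val Y
}.

HB.instance Definition _ := gen_eqMixin upset.
HB.instance Definition _ := gen_choiceMixin upset.

Implicit Types (A B : upset) (S : set upset).

Lemma upset_eqP A B : (forall X, V X -> A X <-> B X) -> A = B.
Proof.
case: A B => [A sA upA] [B sB upB] /= AB.
have {}AB : A = B.
  apply: funext => X; apply/propext.
  by split; [move=> /[dup] /sA|move=> /[dup] /sB]; move=> /AB[].
by case: _ / AB sB upB => sB upB; congr Upset.
Qed.

Definition upset_le A B : bool := `[< forall X, A X -> B X >].

Fact upset_le_refl : reflexive upset_le.
Proof. by move=> A; apply/asboolP. Qed.

Fact upset_le_anti : antisymmetric upset_le.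
Proof.
move=> A B /andP[/asboolP AB /asboolP BA].
by apply: upset_eqP => X _; split=> [/AB|/BA].
Qed.

Fact upset_le_trans : transitive upset_le.
Proof.
move=> B A C /asboolP AB /asboolP BC; apply/asboolP.
by move=> X /AB /BC.
Qed.

HB.instance Definition _ := Order.Le_isPOrder.Build upset_display upset
  upset_le_refl upset_le_anti upset_le_trans.

Definition upset_bigjoin S : upset.
Proof.
refine (@Upset [set X | exists2 A, S A & A X] _ _) => [X [A _]|X Y [A SA AX] VY XY].
  exact: upset_sub.
by exists A => //; apply: upset_up AX VY XY.
Defined.

Definition upset_bigmeet S : upset.
Proof.
refine (@Upset [set X | V X /\ forall A, S A -> A X] _ _) => [X []//|X Y [_ SX] VY XY].
by split=> // A SA; apply: upset_up (SX _ SA) VY XY.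
Defined.

Fact upset_bigjoin_supremum S : supremums S (upset_bigjoin S).
Proof.
split=> [A SA|B ubB]; apply/asboolP => X; first by exists A.
by case=> A SA; move: X; apply/asboolP; apply: ubB.
Qed.

Fact upset_bigmeet_infimum S : infimums S (upset_bigmeet S).
Proof.
split=> [A SA|B lbB]; apply/asboolP => X; first by case=> _; apply.
move=> BX; split=> [|A SA]; first exact: upset_sub BX.
by move: X BX; apply/asboolP; apply: lbB.
Qed.

Fact upset_distr (K : Type) (J : K -> Type) (x : forall k, J k -> upset) :
  upset_bigjoin (range (fun k => upset_bigmeet (range (x k)))) =
  upset_bigmeet (range (fun f : forall k, J k =>
    upset_bigjoin (range (fun k => x k (f k))))).
Proof.
apply: upset_eqP => X VX; split=> [[_ [k _ <-] [_ kX]]|[_ fX]].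
  split=> // _ [f _ <-]; exists (x k (f k)); first by exists k.
  by apply: kX; exists (f k).
apply: contrapT => noX.
(* If [X] is in none of the meets, each [k] has some [j] with [X] outside [x k j]; this choice
   function contradicts [fX]. *)
have ex k : exists j, ~ x k j X.
  apply: contrapT => /forallNP kX; apply: noX.
  exists (upset_bigmeet (range (x k))); first by exists k.
  by split=> // _ [j _ <-]; apply: contrapT; apply: kX.
have [_ [k _ <-]] := fX _ (ex_intro2 _ _ (fun k => projT1 (cid (ex k))) I erefl).
exact: (projT2 (cid (ex k))).
Qed.

HB.instance Definition _ := POrder_isCDL.Build upset_display upset
  upset_bigjoin_supremum upset_bigmeet_infimum upset_distr.

Definition principal_upset (X : set F) : upset.
Proof.
refine (@Upset [set Y | V Y /\ X `<=` Y] _ _) => [Y []//|Y Z [_ XY] VZ YZ].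
by split=> //; apply: subset_trans YZ.
Defined.

Lemma upset_bigjoin_principal A :
  A = bigjoin [set principal_upset X | X in upset_val A].
Proof.
apply: upset_eqP => X VX.
split=> [AX|[_ [Y AY <-] [_ YX]]]; last exact: upset_up AY VX YX.
by exists (principal_upset X); [exists X|split].
Qed.

Lemma upset_cdl_point (X : set F) : V X -> cdl_point [set A : upset | A X].
Proof.
move=> VX; split=> S /=; first by split=> -[A SA AX]; exists A.
by split=> [[_ SX] A|sSX]; [exact: SX|split=> // A /sSX].
Qed.

(** The least element [p] of [P] is a join of principal upsets, so by primeness some [X] in [p] has
    [principal_upset X] in [P]. Then [X] lies in every member of [P], and every upset containing [X]
    is above [principal_upset X]. *)
Lemma upset_cdl_pointP (P : set upset) : cdl_point P ->
  exists2 X, V X & P = [set A : upset | A X].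
Proof.
move=> [Pjoin Pmeet]; pose p := bigmeet P.
have Pp : P p by apply/Pmeet.
have := Pp; rewrite {1}[p]upset_bigjoin_principal => /Pjoin[_ [X pX <-] PX].
exists X; first exact: upset_sub pX.
apply/seteqP; split=> [A PA|A AX] /=; first by case: pX => _; apply.
rewrite [A]upset_bigjoin_principal; apply/Pjoin.
by exists (principal_upset X) => //; exists X.
Qed.

Lemma finite_upset : finite_set V -> finite_set [set: upset].
Proof.
move=> finV; pose trace (A : upset) := [set X : set_type V | A (val X)].
apply: (@finite_set_inj _ _ trace).
  move=> A B AB; apply: upset_eqP => X VX.
  have := congr1 (fun S : set _ => S (SigSub (mem_set VX))) AB.
  by rewrite /trace /= => ->.
by apply: finite_set_sets; rewrite (eq_finite_set (card_setT V)).
Qed.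

End Upsets.

(** * The bimodule of upsets and the syntactic bimodule *)

Section UpsetBimodule.
Variables (F : monoidType) (V : set (set F)).
Hypothesis derivV : forall v w X, V X -> V (deriv v w X).

(** Derivatives act from both sides at once; the left and right actions are the cases [w = 1] and
    [v = 1], so [upset_actM] yields all laws of composition. *)
Definition upset_act (v w : F) (A : upset V) : upset V.
Proof.
refine (@Upset _ V [set X | V X /\ A (deriv v w X)] _ _) => [X []//|X Y [VX AX] VY XY].
split=> //; apply: upset_up AX _ _; first exact: derivV.
by move=> u; apply: XY.
Defined.

Definition upset_iota (u : F) : upset V.
Proof.
by refine (@Upset _ V [set X | V X /\ X u] _ _) => [X []//|X Y [_ Xu] VY /(_ _ Xu)].
Defined.

Lemma upset_actM v w v' w' A :
  upset_act v w (upset_act v' w' A) = upset_act (v * v') (w' * w) A.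
Proof.
apply: upset_eqP => X VX; split=> [[_ [_]]|[_ AX]]; first by rewrite derivM.
by split=> //; split; [exact: derivV|rewrite derivM].
Qed.

Lemma upset_act11 A : upset_act 1 1 A = A.
Proof. by apply: upset_eqP => X VX; rewrite /= deriv11; split=> [[]|]. Qed.

Lemma upset_act_joins v w : preserves_joins (upset_act v w).
Proof.
move=> S; apply: upset_eqP => X VX; split=> [[_ [A SA AX]]|[_ [A SA <-] [_ AX]]].
  by exists (upset_act v w A) => //; exists A.
by split=> //; exists A.
Qed.

Lemma upset_act_meets v w : preserves_meets (upset_act v w).
Proof.
move=> S; apply: upset_eqP => X VX; split=> [[_ [_ SX]]|[_ SX]].
  by split=> // _ [A SA <-]; split=> //; apply: SX.
split=> //; split=> [|A SA]; first exact: derivV.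
by have [|] := SX (upset_act v w A); first by exists A.
Qed.

Lemma upset_act_iota v w u : upset_act v w (upset_iota u) = upset_iota (v * u * w).
Proof.
apply: upset_eqP => X VX; split=> [[_ [_ Xu]]|[_ Xu]]; first by [].
by split=> //; split=> //; apply: derivV.
Qed.

Definition upset_bimodule : lattice_bimodule.
Proof.
refine (@LatticeBimodule F _ (upset V) upset_iota
  (fun m => upset_act m 1) (fun A m => upset_act 1 m A) _ _ _ _ _ _ _ _ _ _ _).
- by move=> m n A; rewrite upset_actM mulg1.
- by move=> A m n; rewrite upset_actM mulg1.
- exact: upset_act11.
- exact: upset_act11.
- by move=> m A n; rewrite !upset_actM !mul1g !mulg1.
- by move=> m; apply: upset_act_joins.
- by move=> m; apply: upset_act_meets.
- by move=> m; apply: upset_act_joins.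
- by move=> m; apply: upset_act_meets.
- by move=> m n; rewrite upset_act_iota mulg1.
- by move=> m n; rewrite upset_act_iota mul1g.
Defined.

(** A set contains [X] exactly when it contains each [u] in [X], so the principal upset of [X] is
    the meet of these [upset_iota u]; any upset is a join of principal ones. *)
Lemma upset_star_generated : star_generated upset_bimodule.
Proof.
move=> A; exists {X | A X}, (fun X => {u | sval X u}), (fun _ u => sval u).
rewrite [LHS]upset_bigjoin_principal; congr bigjoin.
have principalE X : principal_upset V X =
    bigmeet (range (fun u : {u | X u} => upset_iota (sval u))).
  apply: upset_eqP => Y VY; split=> [[_ XY]|[_ XY]]; split=> //.
    by move=> _ [[u Xu] _ <-]; split=> //; apply: XY.
  by move=> u Xu; case: (XY (upset_iota u)) => //; exists (exist _ u Xu).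
apply/seteqP; split=> [_ [X AX <-]|_ [[X AX] _ <-]].
  by exists (exist _ X AX) => //=; rewrite principalE.
by exists X => //=; rewrite principalE.
Qed.

(* For [F] a free monoid and [V] the derivatives of a single language [L], this
   is the syntactic bimodule of [L]. *)
Definition syntactic_bimodule := reduction upset_star_generated.

Definition syntactic_class (u : F) : bim_mon syntactic_bimodule :=
  @iota_class upset_bimodule u.

Lemma syntactic_classP x : exists u, syntactic_class u = x.
Proof. exact: (@iota_classP upset_bimodule x). Qed.

Lemma syntactic_class_morphism : monoid_morphism syntactic_class.
Proof. exact: hom_star_morph (reduction_hom upset_star_generated). Qed.

(** As [V] is closed under derivatives, this relation is the syntactic congruence of [V]. *)
Lemma syntactic_class_eq u v :
  syntactic_class u = syntactic_class v <-> forall X, V X -> X u <-> X v.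
Proof.
rewrite iota_class_eq; split=> [uv X VX|uv]; last first.
  by apply: upset_eqP => X VX; have /= := uv X VX; rewrite /upset_iota /=; tauto.
have := congr1 (fun A : upset V => A X) uv; rewrite /= propeqE; tauto.
Qed.

(** * Homomorphisms out of the syntactic bimodule *)

Section Universal.
Variables (B : lattice_bimodule) (g : F -> bim_mon B).
Hypothesis g_morphism : monoid_morphism g.
Hypothesis finB : finite_set [set: bim_cdl B].
Hypothesis iota_inj : injective (@iota_bim B).
Hypothesis recV : forall P : set (bim_cdl B), cdl_point P ->
  V [set u | P (iota_bim (g u))].

Lemma syntactic_class_inj_comp u v :
  syntactic_class u = syntactic_class v -> g u = g v.
Proof.
move=> /syntactic_class_eq uv; apply: iota_inj; apply: cdl_point_eqP => // P ptP.
exact: uv (recV ptP).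
Qed.

Let h_star (x : bim_mon syntactic_bimodule) := g (projT1 (cid (syntactic_classP x))).

Let h_starE u : h_star (syntactic_class u) = g u.
Proof. by apply: syntactic_class_inj_comp; rewrite /h_star; case: cid. Qed.

(** Forced by duality: on points, the map has to send [P] to the member of [V] that [P] cuts out
    through [g]. *)
Let h_diamond (A : upset V) : bim_cdl B :=
  bigjoin [set bigmeet [set iota_bim (g u) | u in X] | X in upset_val A].

Let h_diamondE (A : upset V) (P : set (bim_cdl B)) : cdl_point P ->
  P (h_diamond A) <-> A [set u | P (iota_bim (g u))].
Proof.
move=> ptP; have [Pjoin Pmeet] := ptP; rewrite Pjoin; split.
  move=> [_ [X AX <-] /Pmeet XP]; apply: upset_up AX (recV ptP) _ => u Xu /=.
  by apply: XP; exists u.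
move=> AP; eexists; first by exists [set u | P (iota_bim (g u))].
by apply/Pmeet => _ [u Pu <-].
Qed.

Lemma syntactic_hom_exists : exists h : bimodule_hom syntactic_bimodule B,
  (forall u, hom_star h (syntactic_class u) = g u) /\
  (forall (A : upset V) P, cdl_point P ->
     P (hom_diamond h A) <-> A [set u | P (iota_bim (g u))]).
Proof.
have [g1 gM] := g_morphism.
have [s1 sM] := syntactic_class_morphism.
unshelve eexists (@BimoduleHom syntactic_bimodule B h_star h_diamond _ _ _ _ _).
- split=> [|x y]; first by rewrite -s1 h_starE.
  have [u <-] := syntactic_classP x; have [v <-] := syntactic_classP y.
  by rewrite -sM !h_starE.
- apply: cdl_morphism_of_points => // P ptP.
  rewrite (_ : _ @^-1` _ = [set A : upset V | A [set u | P (iota_bim (g u))]]).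
    exact: upset_cdl_point (recV ptP).
  by apply/seteqP; split=> A; have [] := h_diamondE A ptP.
(* The laws are tested at a point [P]; composed with the action of [g u] it is a point again, and
   the set it cuts out is the derivative by [u]. *)
- move=> x A; have [u <-] := syntactic_classP x; rewrite h_starE.
  apply: cdl_point_eqP => // P ptP; rewrite h_diamondE //.
  have ptP' := cdl_point_preimage (conj (lact_joins (g u)) (lact_meets (g u))) ptP.
  apply: iff_trans (iff_sym (h_diamondE A ptP')).
  rewrite [lact _ _](lact_reprK upset_star_generated) /=.
  have -> : [set w | P (lact (g u) (iota_bim (g w)))] =
      deriv u 1 [set w | P (iota_bim (g w))].
    by apply/seteqP; split=> w; rewrite /deriv /= mulg1 gM lact_iota.
  by split=> [[]//|AX]; split=> //; apply: recV.
- move=> A x; have [u <-] := syntactic_classP x; rewrite h_starE.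
  apply: cdl_point_eqP => // P ptP; rewrite h_diamondE //.
  have ptP' := cdl_point_preimage (conj (@ract_joins B (g u)) (@ract_meets B (g u))) ptP.
  apply: iff_trans (iff_sym (h_diamondE A ptP')).
  rewrite [ract _ _](ract_reprK upset_star_generated) /=.
  have -> : [set w | P (ract (iota_bim (g w)) (g u))] =
      deriv 1 u [set w | P (iota_bim (g w))].
    by apply/seteqP; split=> w; rewrite /deriv /= mul1g gM ract_iota.
  by split=> [[]//|AX]; split=> //; apply: recV.
- move=> x; have [u <-] := syntactic_classP x; rewrite h_starE.
  apply: cdl_point_eqP => // P ptP; rewrite h_diamondE //.
  by split=> [[]//|Pu]; split=> //; apply: recV.
- by split=> // A P; apply: h_diamondE.
Qed.

End Universal.
End UpsetBimodule.

(** * Recognition of languages *)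

Lemma word_morphism_exists (T : finType) (M : monoidType) (phi : T -> M) :
  exists2 g : word T -> M, monoid_morphism g & forall a, g [:: a] = phi a.
Proof.
exists (foldr (fun a m => phi a * m) 1) => [|a]; last exact: mulg1.
split=> // v w; elim: v => [|a v IHv].
  by rewrite [([::] : word T) * w]mul1g /= mul1g.
by rewrite -[((a :: v) : word T) * w]/(a :: ((v : word T) * w)) /= IHv mulgA.
Qed.

Lemma word_morphism_eq (T : finType) (M : monoidType) (g g' : word T -> M) :
  monoid_morphism g -> monoid_morphism g' ->
  (forall a, g [:: a] = g' [:: a]) -> g = g'.
Proof.
move=> [g1 gM] [g'1 g'M] gg'; apply: funext; elim=> [|a w IHw].
  by rewrite -[[::]]/(1 : word T) g1 g'1.
by rewrite -[a :: w]/(([:: a] : word T) * w) gM g'M gg' IHw.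
Qed.

Lemma monoid_morphism_comp (M N K : monoidType) (f : M -> N) (g : N -> K) :
  monoid_morphism f -> monoid_morphism g -> monoid_morphism (g \o f).
Proof.
by move=> [f1 fM] [g1 gM]; split=> [|x y] /=; rewrite ?f1 ?g1 ?fM ?gM.
Qed.

(** Free monoids are projective: it suffices to choose a preimage under [e] for the image of each
    letter. *)
Lemma word_morphism_lift (T : finType) (M N : monoidType) (e : M -> N)
    (g : word T -> N) : monoid_morphism e -> (forall y, exists x, e x = y) ->
    monoid_morphism g ->
  exists2 g' : word T -> M, monoid_morphism g' & e \o g' = g.
Proof.
move=> emor esurj gmor.
have /choice[phi phiE] a : exists x, e x = g [:: a] by apply: esurj.
have [g' g'mor g'E] := word_morphism_exists phi; exists g' => //.
apply: word_morphism_eq => // [|a]; first exact: monoid_morphism_comp.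
by rewrite /= g'E.
Qed.

Definition recognized_by (F : monoidType) (B : lattice_bimodule)
    (g : F -> bim_mon B) : set (set F) :=
  [set X | exists2 P : set (bim_cdl B),
    cdl_point P & X = [set u | P (iota_bim (g u))]].

Lemma recognized_by_deriv (F : monoidType) B (g : F -> bim_mon B) v w X :
  monoid_morphism g -> recognized_by g X -> recognized_by g (deriv v w X).
Proof.
move=> [_ gM] [P ptP ->].
have ptl := cdl_point_preimage (conj (lact_joins (g v)) (lact_meets (g v))) ptP.
have ptlr := cdl_point_preimage (conj (@ract_joins B (g w)) (@ract_meets B (g w))) ptl.
exists [set x | P (lact (g v) (ract x (g w)))] => //; apply/seteqP.
by split=> u; rewrite /deriv /= ract_iota lact_iota !gM mulgA.
Qed.

Definition recognized (B : lattice_bimodule) (S : finType) (L : language S) :=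
  exists2 g : word S -> bim_mon B, monoid_morphism g & recognized_by g L.

Lemma recognized_derivative B (S : finType) (L : language S) v w :
  recognized B L -> recognized B (derivative v w L).
Proof. by move=> [g gmor gL]; exists g => //; apply: recognized_by_deriv. Qed.

Lemma recognized_preimage B (S T : finType) (L : language S) (g : word T -> word S) :
  monoid_morphism g -> recognized B L -> recognized B (g @^-1` L).
Proof.
move=> gmor [f fmor [P ptP ->]]; exists (f \o g); last by exists P.
exact: monoid_morphism_comp.
Qed.

Lemma recognized_regular B (S : finType) (L : language S) :
  finite_set [set: bim_mon B] -> recognized B L -> regular L.
Proof.
move=> /finite_set_enum[n [e esurj]] [g [g1 gM] [P _ ->]].
have /choice[code codeE] : forall m, exists i, e i = m by [].
(* States are indices of monoid elements; reading a letter multiplies by its image, so the run on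
   [w] ends at an index of [g w]. *)
exists 'I_n, (code 1), (fun q a => code (e q * g [:: a])),
  [set i | `[< P (iota_bim (e i)) >]]%SET.
apply/seteqP.
suff E w : e (foldl (fun q a => code (e q * g [:: a])) (code 1) w) = g w.
  by split=> w; rewrite /= inE E => /asboolP.
suff E q : e (foldl (fun q a => code (e q * g [:: a])) q w) = e q * g w.
  by rewrite E codeE mul1g.
elim: w q => [|a w IHw] q; first by rewrite -[[::]]/(1 : word S) g1 mulg1.
by rewrite /= IHw codeE -mulgA -gM.
Qed.

(** The morphism from words lifts along the surjection [hom_star e], and the point is pulled back
    along [hom_diamond e]. *)
Lemma recognized_quotient B B' (e : bimodule_hom B B') (S : finType)
    (L : language S) : hom_surjective e -> recognized B' L -> recognized B L.
Proof.
move=> [surjs _] [g gmor [P ptP ->]].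
have [m|g' g'mor g'E] := word_morphism_lift (hom_star_morph e) _ gmor.
  by have [x _ <-] := surjs m I; exists x.
exists g' => //; exists (hom_diamond e @^-1` P).
  exact: cdl_point_preimage (hom_diamond_morph e) ptP.
by apply/seteqP; split=> w; rewrite -g'E /= hom_iota.
Qed.

(** A point of a subbimodule is induced from a point of a single factor, and [g] followed by [h] and
    the projection recognises the same language there. *)
Lemma recognized_subprod (I : finType) (Bs : I -> lattice_bimodule) B
    (h : bimodule_hom B (prod_bimodule Bs)) (S : finType) (L : language S) :
  (forall i, finite_bimodule (Bs i)) -> hom_injective h -> recognized B L ->
  exists i, recognized (Bs i) L.
Proof.
move=> finBs [_ injd] [g gmor [P ptP ->]].
have [i [P' [ptP' PE]]] := cdl_point_subprod (fun i => (finBs i).2)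
  (hom_diamond_morph h) injd ptP.
have [h1 hM] := hom_star_morph h; have [g1 gM] := gmor.
exists i, (fun w => hom_star h (g w) i); last exists P' => //.
  by split=> [|v w]; rewrite ?g1 ?h1 ?gM ?hM.
by rewrite PE; apply/seteqP; split=> w; rewrite /= hom_iota.
Qed.

Section SyntacticRecognition.
Variables (S : finType) (V : set (language S)).
Hypothesis derivV : forall v w (X : language S), V X -> V (deriv v w X).

Let B := syntactic_bimodule derivV.

Lemma recognized_syntactic X : V X -> recognized B X.
Proof.
move=> VX; exists (syntactic_class derivV); first exact: syntactic_class_morphism.
exists [set A : upset V | A X]; first exact: upset_cdl_point.
by apply/seteqP; split=> u => [Xu|[]].
Qed.

(** Words over [S] cover the syntactic monoid, so the recognising morphism lifts to them, and a
    point of the upsets of [V] is membership of some [X] in [V]. *)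
Lemma recognized_syntacticP (T : finType) (L : language T) : recognized B L ->
  exists (g : word T -> word S) X,
    [/\ monoid_morphism g, V X & L = g @^-1` X].
Proof.
move=> [g gmor [P ptP ->]].
have [g' g'mor <-] := word_morphism_lift (syntactic_class_morphism derivV)
  (@syntactic_classP _ _ derivV) gmor.
have [X VX ->] := upset_cdl_pointP ptP; exists g', X; split=> //.
by apply/seteqP; split=> w => [[]|].
Qed.

Lemma syntactic_star_generated : star_generated B.
Proof. exact: reduction_star_generated. Qed.

Lemma syntactic_reduced : reduced B.
Proof. exact: reduction_reduced. Qed.

Lemma syntactic_finite : finite_set V -> finite_bimodule B.
Proof. by move=> finV; apply/reduction_finite/finite_upset. Qed.

End SyntacticRecognition.

(** A derivative depends only on the state reached by [v] and on the set of states from which [w]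
    leads to acceptance. *)
Lemma regular_finite_derivatives (S : finType) (L : language S) : regular L ->
  finite_set [set X | exists v w, X = derivative v w L].
Proof.
move=> [Q [q0 [delta [F ->]]]].
pose X (p : Q * {set Q}) : language S := [set u | foldl delta p.1 u \in p.2].
apply: (@finite_set_surj _ _ _ X) => _ [v [w ->]].
exists (foldl delta q0 v, [set q | foldl delta q w \in F]%SET).
apply/seteqP.
by split=> u; rewrite /X /derivative /= inE -!foldl_cat -[_ * w]mulgA.
Qed.

(** * The correspondence *)

Section PseudovarietyOf.
Variable W : basic_variety.

Definition pseudovariety_of_class (B : lattice_bimodule) :=
  [/\ star_generated B, reduced B, finite_bimodule B
    & forall (S : finType) (L : language S), recognized B L -> bv_langs W S L].

Definition pseudovariety_of : pseudovariety.
Proof.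
refine (@Pseudovariety pseudovariety_of_class _ _ _).
- by move=> B [].
- move=> B B' e [sgB redB finB recB] esurj redB'; split=> //.
  + exact: star_generated_surj esurj sgB.
  + exact: finite_bimodule_surj esurj finB.
  + by move=> S L /(recognized_quotient esurj); apply: recB.
- move=> n Bs B h hinj memBs sgB; have [injs injd] := hinj.
  have finBs i : finite_bimodule (Bs i) by case: (memBs i).
  split=> //.
  (* Reducedness amounts to injectivity of [iota_bim], which is inherited componentwise from the
     factors. *)
  + apply: iota_inj_reduced => x y xy; apply: injs.
    apply: functional_extensionality_dep => i.
    have [sgi redi _ _] := memBs i.
    apply: (reduced_iota_inj sgi redi).
    have := congr1 (fun z => hom_diamond h z i) xy.
    by rewrite !hom_iota.
  + split; [apply: finite_set_inj injs _|apply: finite_set_inj injd _];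
      apply: finite_set_prod => i; by case: (finBs i).
  + move=> S L /(recognized_subprod finBs hinj)[i].
    by have [_ _ _] := memBs i; apply.
Defined.

End PseudovarietyOf.

Section BasicVarietyOf.
Variable V : pseudovariety.

Definition basic_variety_of_langs (S : finType) (L : language S) :=
  exists2 B, pv_class V B & recognized B L.

Definition basic_variety_of : basic_variety.
Proof.
refine (@BasicVariety basic_variety_of_langs _ _).
- move=> S; split=> [L [B VB]|L v w [B VB recL]].
    by apply: recognized_regular; have [_ _ []] := pv_members VB.
  by exists B => //; apply: recognized_derivative.
- move=> S T g L gmor [B VB recL]; exists B => //.
  exact: recognized_preimage.
Defined.

End BasicVarietyOf.

(** * The two constructions are mutually inverse *)

Lemma basic_variety_le_anti V W :
  basic_variety_le V W -> basic_variety_le W V -> V = W.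
Proof.
case: V W => [V lV pV] [W lW pW] VW WV.
have VE : V = W.
  apply: functional_extensionality_dep => S; apply/seteqP.
  by split; [apply: VW|apply: WV].
by case: _ / VE lW pW {VW WV} => lW pW; congr BasicVariety.
Qed.

Lemma pseudovariety_le_anti V W :
  pseudovariety_le V W -> pseudovariety_le W V -> V = W.
Proof.
case: V W => [V mV qV sV] [W mW qW sW] VW WV.
have VE : V = W by apply: funext => B; apply/propext; split; [apply: VW|apply: WV].
by case: _ / VE mW qW sW {VW WV} => mW qW sW; congr Pseudovariety.
Qed.

Lemma pseudovariety_ofK : cancel pseudovariety_of basic_variety_of.
Proof.
move=> W; apply: basic_variety_le_anti => S L; first by case=> B [_ _ _]; apply.
move=> WL; have [regW derivW] := bv_local W S.
pose V := [set X | exists v w, X = derivative v w L].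
have derivV v w X : V X -> V (deriv v w X).
  by move=> [v' [w' ->]]; exists (v' * v), (w * w'); apply: derivM.
exists (syntactic_bimodule derivV); last first.
  by apply: recognized_syntactic; exists 1, 1; rewrite -[RHS]/(deriv 1 1 L) deriv11.
split; [exact: syntactic_star_generated|exact: syntactic_reduced| |].
  by apply: syntactic_finite; apply: regular_finite_derivatives; apply: regW.
move=> T K /recognized_syntacticP[g [_ [gmor [v [w ->]] ->]]].
by apply: bv_preimage => //; apply: derivW.
Qed.

Definition hom_pair (I : Type) (B : lattice_bimodule) (Bs : I -> lattice_bimodule)
    (h : forall i, bimodule_hom B (Bs i)) : bimodule_hom B (prod_bimodule Bs).
Proof.
refine (@BimoduleHom B (prod_bimodule Bs) (fun m i => hom_star (h i) m)
  (fun x i => hom_diamond (h i) x) _ _ _ _ _).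
- by split=> [|m n]; apply: functional_extensionality_dep => i;
    case: (hom_star_morph (h i)) => h1 hM; rewrite ?h1 ?hM.
- split=> A; apply: functional_extensionality_dep => i;
    case: (hom_diamond_morph (h i)) => hjoin hmeet.
    by rewrite hjoin /bigjoin /= /prod_bigjoin image_comp.
  by rewrite hmeet /bigmeet /= /prod_bigmeet image_comp.
- by move=> m x; apply: functional_extensionality_dep => i; apply: hom_lact.
- by move=> x m; apply: functional_extensionality_dep => i; apply: hom_ract.
- by move=> m; apply: functional_extensionality_dep => i; apply: hom_iota.
Defined.

Lemma star_surjective_hom (B B' : lattice_bimodule) (h : bimodule_hom B B') :
  star_generated B' -> (forall y, exists x, hom_star h x = y) -> hom_surjective h.
Proof.
move=> sgB' surjs; split=> y _; first by have [x <-] := surjs y; exists x.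
have [J [K [m ->]]] := sgB' y; have /choice[f fE] := surjs.
exists (bigjoin (range (fun j =>
  bigmeet (range (fun k => iota_bim (f (m j k))))))) => //.
have [hjoin hmeet] := hom_diamond_morph h.
rewrite hjoin image_comp; congr bigjoin; apply: eq_imagel => j _ /=.
rewrite hmeet image_comp; congr bigmeet; apply: eq_imagel => k _ /=.
by rewrite hom_iota fE.
Qed.

Lemma basic_variety_ofK : cancel basic_variety_of pseudovariety_of.
Proof.
move=> V; apply: pseudovariety_le_anti => B; last first.
  move=> VB; have [sgB redB finB] := pv_members VB.
  by split=> // S L recL; exists B.
move=> [sgB redB [finM finD] recB].
have iota_inj := reduced_iota_inj sgB redB.
(* The letters enumerate the monoid of [B], so that [g] is onto. *)
have [n [phi phisurj]] := finite_set_enum finM.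
have [g gmor gE] := word_morphism_exists phi.
have gsurj y : exists w, g w = y by have [i <-] := phisurj y; exists [:: i].
pose pts := {P : set (bim_cdl B) | cdl_point P}.
have finpts : finite_set [set: pts].
  apply: (@finite_set_inj _ _ sval) (finite_set_sets finD).
  by case=> P ptP [Q ptQ] /= PQ; apply: eq_exist.
have [k [e esurj]] := finite_set_enum finpts.
(* The language cut out by the [i]-th point over this alphabet; by [recB] some member [Bs i] of [V]
   recognises it. *)
pose L i : language 'I_n := [set w | sval (e i) (iota_bim (g w))].
have /choice[Bs BsP] i : exists B', pv_class V B' /\ recognized B' (L i).
  have [] := recB 'I_n (L i).
    by exists g => //; exists (sval (e i)) => //; apply: svalP.
  by move=> B' VB' recB'; exists B'.
pose gs i := projT1 (cid2 (BsP i).2).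
have gsmor i : monoid_morphism (gs i) by rewrite /gs; case: cid2.
have gsL i : recognized_by (gs i) (L i) by rewrite /gs; case: cid2.
(* The syntactic bimodule of [U] mediates: it embeds into the product of the [Bs i] because [U]
   consists of exactly the sets recognised through the [gs i], and it maps onto [B] because [U]
   contains every [L i]. *)
pose U : set (language 'I_n) := \bigcup_(i in [set: 'I_k]) recognized_by (gs i).
have derivU v w X : U X -> U (deriv v w X).
  by case=> i _ gX; exists i => //; apply: recognized_by_deriv.
have finBs i : finite_set [set: bim_cdl (Bs i)].
  by have [_ _ []] := pv_members (BsP i).1.
have Bsinj i : injective (@iota_bim (Bs i)).
  by have [sgi redi _] := pv_members (BsP i).1; apply: reduced_iota_inj.
have hs_ex i : exists h : bimodule_hom (syntactic_bimodule derivU) (Bs i), _ :=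
  syntactic_hom_exists derivU (gsmor i) (finBs i) (Bsinj i)
    (fun P ptP => ex_intro2 _ _ i I (ex_intro2 _ _ P ptP erefl)).
pose hs i := projT1 (cid (hs_ex i)).
have hs_star i u : hom_star (hs i) (syntactic_class derivU u) = gs i u.
  by rewrite /hs; case: cid => h [].
have hs_diamond i (A : upset U) P : cdl_point P ->
    P (hom_diamond (hs i) A) <-> A [set u | P (iota_bim (gs i u))].
  by rewrite /hs; case: cid => h /= [_]; apply.
have VN : pv_class V (syntactic_bimodule derivU).
  apply: (@pv_subprod V k Bs _ (hom_pair hs)); last exact: syntactic_star_generated.
    (* Each [X] in [U] is cut out by a point of some [Bs i], so the [hs i] together separate both
       classes and upsets. *)
    split=> [x y|A A' AA'].
      have [u <-] := syntactic_classP x.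
      have [v <-] := syntactic_classP y => uv.
      apply/syntactic_class_eq => X [i _ [P _ ->]] /=.
      by have := congr1 (fun f => f i) uv; rewrite /= !hs_star => ->.
    apply: (@upset_eqP _ U) => X [i _ [P ptP ->]].
    rewrite -!hs_diamond //; have := congr1 (fun f => f i) AA' => /= ->.
    by [].
  by move=> i; have [] := BsP i.
have recU P : cdl_point P -> U [set u | P (iota_bim (g u))].
  move=> ptP; have [i ei] := esurj (exist _ P ptP); exists i => //.
  by have := gsL i; rewrite /L ei.
have [h [hE _]] := syntactic_hom_exists derivU gmor finD iota_inj recU.
apply: (@pv_quotient V _ _ h VN _ redB).
apply: star_surjective_hom => // y.
by have [w <-] := gsurj y; exists (syntactic_class derivU w).
Qed.

(** * Order and lattice structure *)

Lemma pseudovariety_of_le V W :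
  basic_variety_le V W <-> pseudovariety_le (pseudovariety_of V) (pseudovariety_of W).
Proof.
split=> [VW B [sgB redB finB recB]|VW S L].
  by split=> // S L /recB; apply: VW.
rewrite -{1}[V]pseudovariety_ofK -[W]pseudovariety_ofK => -[B VB recL].
by exists B => //; apply: VW.
Qed.

(** Both closure conditions concern one language at a time, so unions and intersections taken
    alphabet by alphabet are again basic varieties. *)
Lemma basic_variety_lattice : is_lattice basic_variety_le.
Proof.
split.
- by split=> [V S|V W U VW WU S] //; apply: subset_trans (VW S) (WU S).
- exact: basic_variety_le_anti.
- move=> V W.
  have loc S : local_basic_variety (bv_langs V S `|` bv_langs W S).
    have [regV dV] := bv_local V S; have [regW dW] := bv_local W S.
    split=> [L []|L v w [VL|WL]]; [exact: regV|exact: regW| |].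
      by left; apply: dV.
    by right; apply: dW.
  have pre (S T : finType) (g : word T -> word S) L : monoid_morphism g ->
      (bv_langs V S `|` bv_langs W S) L ->
      (bv_langs V T `|` bv_langs W T) (g @^-1` L).
    by move=> gmor [VL|WL]; [left|right]; apply: bv_preimage.
  exists (BasicVariety loc pre); split=> [S L|S L|U VU WU S L]; first by left.
    by right.
  by case=> [/VU|/WU].
- move=> V W.
  have loc S : local_basic_variety (bv_langs V S `&` bv_langs W S).
    have [regV dV] := bv_local V S; have [regW dW] := bv_local W S.
    by split=> [L [/regV]|L v w [VL WL]] //; split; [exact: dV|exact: dW].
  have pre (S T : finType) (g : word T -> word S) L : monoid_morphism g ->
      (bv_langs V S `&` bv_langs W S) L ->
      (bv_langs V T `&` bv_langs W T) (g @^-1` L).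
    by move=> gmor [VL WL]; split; apply: bv_preimage.
  exists (BasicVariety loc pre); split=> [S L []|S L []|U UV UW S L UL] //.
  by split; [exact: UV|exact: UW].
Qed.

(** Serves to obtain joins and meets of pseudovarieties from those of basic varieties. *)
Lemma is_lattice_iso (T U : Type) (leT : T -> T -> Prop) (leU : U -> U -> Prop)
    (f : T -> U) :
  lattice_isomorphism leT leU f -> is_lattice leT -> is_lattice leU.
Proof.
move=> [[g fK gK] fle] [[rT tT] aT jT mT].
have gle x y : leU x y <-> leT (g x) (g y) by rewrite fle !gK.
split.
- split=> [x|x y z]; rewrite !gle //; exact: tT.
- by move=> x y; rewrite !gle => xy /(aT _ _ xy)/(can_inj gK).
- move=> x y; have [z [xz yz zmin]] := jT (g x) (g y).
  by exists (f z); split=> [||t]; rewrite !gle fK //; apply: zmin.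
- move=> x y; have [z [zx zy zmax]] := mT (g x) (g y).
  by exists (f z); split=> [||t]; rewrite !gle fK //; apply: zmax.
Qed.

Theorem theorem5p1 :
  [/\ is_lattice basic_variety_le,
      is_lattice pseudovariety_le
    & exists f : basic_variety -> pseudovariety,
        lattice_isomorphism basic_variety_le pseudovariety_le f].
Proof.
have iso : lattice_isomorphism basic_variety_le pseudovariety_le pseudovariety_of.
  split; last exact: pseudovariety_of_le.
  by exists basic_variety_of; [exact: pseudovariety_ofK|exact: basic_variety_ofK].
split; [exact: basic_variety_lattice| |by exists pseudovariety_of].
exact: is_lattice_iso iso basic_variety_lattice.
Qed.
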